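(* (Completeness) For every set $\Gamma\cup\{\phi\}$ of $\mathcal{L}^+$-sentences, where $\mathcal{L}$ has arbitrary cardinality: if $\Gamma\models\phi$ then $\Gamma\vdash\phi$ (i.e. $\phi$ is derivable from $\Gamma$ in $\mathcal{N}\mathsf{BQL}_{\mathsf{CD}}^r$).
   Context: Language. $\mathcal{L}$ is an arbitrary first-order language with primitive operators $\top,\bot,\wedge,\vee,\rightarrow,\forall,\exists$ (identity, if present, is a non-logical relation symbol), and $\mathcal{L}^+=\mathcal{L}\cup\{a_i:i\in\omega\}$ with each $a_i$ a fresh constant symbol. $\phi(t)$ is the result of substituting the closed term $t$ for the variable $v$ in $\phi$. Proof system. $\mathcal{N}\mathsf{BQL}_{\mathsf{CD}}^r$ consists of all finite trees of (possibly discharged) $\mathcal{L}^+$-sentences (leaves are open assumptions unless discharged) built by the rules: $\top$-Int: $\top$ may be used as a leaf that counts as discharged. $\bot$-Elim: from $\bot$ infer $\phi$. $\wedge$-Int: from $\phi$ and $\psi$ infer $\phi\wedge\psi$. $\wedge$-Elim: from $\phi\wedge\psi$ infer $\phi$; likewise $\psi$. $\vee$-Int: from $\phi$ infer $\phi\vee\psi$; likewise from $\psi$. $\vee$-Elim: from $\phi\vee\psi$, a subproof of $\chi$ (discharging $\phi$) and a subproof of $\chi$ (discharging $\psi$), infer $\chi$. $\rightarrow$-Int: from a subproof of $\psi$ (discharging $\phi$) infer $\phi\rightarrow\psi$. $\rightarrow$-Elim: from $\phi$ (left premise) and $\phi\rightarrow\psi$ (right premise) infer $\psi$. Internal Transitivity: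 from $\phi\rightarrow\psi$ and $\psi\rightarrow\chi$ infer $\phi\rightarrow\chi$. Internal $\wedge$-Int: from $\phi\rightarrow\psi$ and $\phi\rightarrow\chi$ infer $\phi\rightarrow\psi\wedge\chi$. Internal $\vee$-Elim: from $\phi\rightarrow\chi$ and $\psi\rightarrow\chi$ infer $\phi\vee\psi\rightarrow\chi$. Internal $\forall$-Int: from $\forall v(\phi\rightarrow\psi)$ infer $\phi\rightarrow\forall v\psi$. Internal $\exists$-Elim: from $\forall v(\phi\rightarrow\psi)$ infer $\exists v\phi\rightarrow\psi$. $\forall$-Int: from $\phi(a_i)$ infer $\forall v\phi$. $\forall$-Elim: from $\forall v\phi$ infer $\phi(t)$. CD: from $\forall v(\phi\vee\psi)$ infer $\phi\vee\forall v\psi$. $\exists$-Int: from $\phi(t)$ infer $\exists v\phi$. $\exists$-Elim: from $\exists v\phi$ and a subproof of $\psi$ (discharging $\phi(a_i)$) infer $\psi$. Restrictions: (C1) only sentences occur in proofs (so, e.g., $\phi$ has no free variables in CD); (C2) in $\forall$-Int, $a_i$ may not occur in $\phi$ or in any open assumption of the subproof of $\phi(a_i)$; (C3) in $\exists$-Elim, $a_i$ may not occur in $\phi$, $\psi$ or any open assumption other than $\phi(a_i)$ of the subproof of $\psi$; (C4) in $\exists$-Elim all open occurrences of $\phi(a_i)$ in the subproof of $\psi$ must be discharged, while in the other discharging rules any number (including zero) of open occurrences of the indicated assumption may be discharged; (C5) no unsafe occurrence of an open assumption may be discharged, where an occurrence of a (possibly discharged) assumption at a leaf is unsafe in a proof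 if it lies in the subtree ending in the right premise $\alpha\rightarrow\beta$ of some application of $\rightarrow$-Elim (including the case where the leaf is that premise itself). $\Gamma\vdash\phi$ iff there is such a proof with root $\phi$ whose open assumptions all belong to $\Gamma$. Semantics. For a first-order language $\mathcal{K}$, a $\mathcal{K}$-model is $\mathfrak{M}=\langle W,\prec,M,|\cdot|\rangle$ with $W$ a non-empty set of worlds, $\prec$ a transitive relation on $W$ (not necessarily reflexive), $M$ a non-empty set, and $|\cdot|$ an interpretation with $|c|\in M$, $|f^n|:M^n\to M$, $|R^n|:W\to\mathcal{P}(M^n)$, such that $w\prec u$ implies $|R^n|(w)\subseteq|R^n|(u)$. Terms denote as usual. Satisfaction $w\Vdash\phi(\overline{a})$: atomic formulas $R^n(\overline{t})$ hold at $w$ iff the tuple of denotations is in $|R^n|(w)$; $\top$ always holds and $\bot$ never; $\wedge,\vee$ are evaluated locally at $w$; $w\Vdash(\phi\rightarrow\psi)(\overline{a})$ iff for all $u$ with $w\prec u$, $u\Vdash\phi(\overline{a})$ implies $u\Vdash\psi(\overline{a})$; $w\Vdash\exists v\phi(\overline{a})$ (resp. $\forall v\phi(\overline{a})$) iff $w\Vdash\phi(\overline{a},b)$ for some (resp. all) $b\in M$. $w$ is reflexive if $w\prec w$. For $\mathcal{L}^+$-sentences, $\Gamma\models\phi$ iff for every $\mathcal{L}^+$-model and every reflexive world $w$ in it, if $w$ satisfies all of $\Gamma$ then $w\Vdash\phi$. *)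

(* Defs.v *)
From mathcomp Require Import all_boot.
From Stdlib Require List.

Set Implicit Arguments.
Unset Strict Implicit.
Unset Printing Implicit Defensive.

(** ** Languages, terms and formulas *)

(* No restriction is put on the types of symbols: they may have any
   cardinality and need not have decidable equality. *)
Record language := Language {
  cst : Type;
  fsym : Type;
  far : fsym -> nat;
  rsym : Type;
  rar : rsym -> nat }.

Definition plus (L : language) : language :=
  Language (cst L + nat)%type (@far L) (@rar L).

Inductive term (K : language) : Type :=
| Var of nat
| Cst of cst K
| App (f : fsym K) of ('I_(far f) -> term K).

Arguments Var {K}.
Arguments Cst {K}.
Arguments App {K}.

Inductive form (K : language) : Type :=
| Atom (r : rsym K) of ('I_(rar r) -> term K)
| Top
| Bot
| And of form K & form K
| Or of form K & form K
| Imp of form K & form K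
| All of nat & form K
| Ex of nat & form K.

Arguments Atom {K}.
Arguments Top {K}.
Arguments Bot {K}.

Section Syntax.
Variable K : language.
Implicit Types (v x : nat) (c : cst K) (t s : term K) (phi psi : form K).

Fixpoint tfree x t : Prop :=
  match t with
  | Var y => x = y
  | Cst _ => False
  | App f ts => exists i, tfree x (ts i)
  end.

Fixpoint free x phi : Prop :=
  match phi with
  | Atom r ts => exists i, tfree x (ts i)
  | Top | Bot => False
  | And p q | Or p q | Imp p q => free x p \/ free x q
  | All y p | Ex y p => x <> y /\ free x p
  end.

Definition closed t : Prop := forall x, ~ tfree x t.
Definition sentence phi : Prop := forall x, ~ free x phi.

Fixpoint toccurs c t : Prop :=
  match t with
  | Var _ => False
  | Cst d => c = d
  | App f ts => exists i, toccurs c (ts i)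
  end.

Fixpoint occurs c phi : Prop :=
  match phi with
  | Atom r ts => exists i, toccurs c (ts i)
  | Top | Bot => False
  | And p q | Or p q | Imp p q => occurs c p \/ occurs c q
  | All _ p | Ex _ p => occurs c p
  end.

Fixpoint tsubst v s t : term K :=
  match t with
  | Var x => if x == v then s else Var x
  | Cst c => Cst c
  | App f ts => App f (fun i => tsubst v s (ts i))
  end.

(* Capture is not avoided: [subst] is only used with a closed [s]. *)
Fixpoint subst v s phi : form K :=
  match phi with
  | Atom r ts => Atom r (fun i => tsubst v s (ts i))
  | Top => Top
  | Bot => Bot
  | And p q => And (subst v s p) (subst v s q)
  | Or p q => Or (subst v s p) (subst v s q)
  | Imp p q => Imp (subst v s p) (subst v s q)
  | All x p => All x (if x == v then p else subst v s p)
  | Ex x p => Ex x (if x == v then p else subst v s p)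
  end.

End Syntax.

(** ** Constant-domain Kripke models on transitive frames *)

Record model (K : language) := Model {
  world : Type;
  prec : world -> world -> Prop;
  dom : Type;
  icst : cst K -> dom;
  ifun : forall f : fsym K, ('I_(far f) -> dom) -> dom;
  irel : forall r : rsym K, world -> ('I_(rar r) -> dom) -> Prop;
  world_inh : inhabited world;
  dom_inh : inhabited dom;
  prec_trans : forall w u z, prec w u -> prec u z -> prec w z;
  irel_mono : forall r w u, prec w u ->
    forall d, irel (r := r) w d -> irel (r := r) u d }.

Section Semantics.
Variables (K : language) (M : model K).
Implicit Types (e : nat -> dom M) (w u : world M).

Definition upd e v (b : dom M) : nat -> dom M :=
  fun x => if x == v then b else e x.

Fixpoint eval e (t : term K) : dom M :=
  match t with
  | Var x => e x
  | Cst c => icst M c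
  | App f ts => ifun (fun i => eval e (ts i))
  end.

Fixpoint sat w e (phi : form K) : Prop :=
  match phi with
  | Atom r ts => irel w (fun i => eval e (ts i))
  | Top => True
  | Bot => False
  | And p q => sat w e p /\ sat w e q
  | Or p q => sat w e p \/ sat w e q
  | Imp p q => forall u, prec w u -> sat u e p -> sat u e q
  | All v p => forall b, sat w (upd e v b) p
  | Ex v p => exists b, sat w (upd e v b) p
  end.

(* Only used for sentences, where the assignment is irrelevant; assignments
   exist because the domain is inhabited. *)
Definition holds w (phi : form K) : Prop := forall e, sat w e phi.

End Semantics.

Definition entails (K : language) (Gamma : form K -> Prop) (phi : form K) :=
  forall (M : model K) (w : world M), prec w w ->
    (forall psi, Gamma psi -> holds w psi) -> holds w phi.

(** ** Natural deduction *)

Section Deduction.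
Variable L : language.
Notation sent := (form (plus L)).
Implicit Types (phi psi chi : sent) (v i : nat) (t : term (plus L)).

Definition acst i : cst (plus L) := inr i.
Definition a_ i : term (plus L) := Cst (acst i).

(* An occurrence of an open assumption at a leaf of a proof: the assumption,
   and whether that occurrence is unsafe in that proof. *)
Definition leaf : Type := (sent * bool)%type.
Implicit Types (G H : seq leaf).

Definition mark_unsafe G : seq leaf := [seq (o.1, true) | o <- G].

Definition fresh_in i G : Prop :=
  forall o, List.In o G -> ~ occurs (acst i) o.1.

(* [discharge phi G H]: H is obtained from G by removing any number of safe
   occurrences of phi. *)
Inductive discharge phi : seq leaf -> seq leaf -> Prop :=
| discharge_nil : discharge phi [::] [::]
| discharge_drop G H :
    discharge phi G H -> discharge phi ((phi, false) :: G) H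
| discharge_keep o G H :
    discharge phi G H -> discharge phi (o :: G) (o :: H).

(* [proof G phi] is the type of proof trees with root phi whose leaves carrying
   an open assumption are, from left to right, those listed in G.  An
   occurrence is discharged as soon as it leaves the list, so its safety is
   judged in the subproof that ends just above the discharging inference; it
   may well lie above the right premise of an [ImpE] further down.

   Only sentences occur in proofs: the hypotheses [sentence _] below are those
   that do not follow from the premises of a rule being sentences (see
   [proof_sentence]). *)
Inductive proof : seq leaf -> sent -> Type :=
| Assume phi :
    sentence phi -> proof [:: (phi, false)] phi
| TopI :
    proof [::] Top
| BotE G phi :
    sentence phi -> proof G Bot -> proof G phi
| AndI G1 G2 phi psi :
    proof G1 phi -> proof G2 psi -> proof (G1 ++ G2) (And phi psi)
| AndE1 G phi psi :
    proof G (And phi psi) -> proof G phi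
| AndE2 G phi psi :
    proof G (And phi psi) -> proof G psi
| OrI1 G phi psi :
    sentence psi -> proof G phi -> proof G (Or phi psi)
| OrI2 G phi psi :
    sentence phi -> proof G psi -> proof G (Or phi psi)
| OrE G G1 G2 H1 H2 phi psi chi :
    proof G (Or phi psi) ->
    proof G1 chi -> discharge phi G1 H1 ->
    proof G2 chi -> discharge psi G2 H2 ->
    proof (G ++ H1 ++ H2) chi
| ImpI G H phi psi :
    sentence phi -> proof G psi -> discharge phi G H ->
    proof H (Imp phi psi)
| ImpE G1 G2 phi psi :
    proof G1 phi -> proof G2 (Imp phi psi) ->
    proof (G1 ++ mark_unsafe G2) psi
| IntTrans G1 G2 phi psi chi :
    proof G1 (Imp phi psi) -> proof G2 (Imp psi chi) ->
    proof (G1 ++ G2) (Imp phi chi)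
| IntAndI G1 G2 phi psi chi :
    proof G1 (Imp phi psi) -> proof G2 (Imp phi chi) ->
    proof (G1 ++ G2) (Imp phi (And psi chi))
| IntOrE G1 G2 phi psi chi :
    proof G1 (Imp phi chi) -> proof G2 (Imp psi chi) ->
    proof (G1 ++ G2) (Imp (Or phi psi) chi)
| IntAllI G v phi psi :
    sentence phi -> proof G (All v (Imp phi psi)) ->
    proof G (Imp phi (All v psi))
| IntExE G v phi psi :
    sentence psi -> proof G (All v (Imp phi psi)) ->
    proof G (Imp (Ex v phi) psi)
| AllI G v i phi :
    ~ occurs (acst i) phi -> fresh_in i G ->
    proof G (subst v (a_ i) phi) -> proof G (All v phi)
| AllE G v t phi :
    closed t -> proof G (All v phi) -> proof G (subst v t phi)
| CD G v phi psi :
    sentence phi -> proof G (All v (Or phi psi)) ->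
    proof G (Or phi (All v psi))
| ExI G v t phi :
    closed t -> proof G (subst v t phi) -> proof G (Ex v phi)
| ExE G1 G2 H2 v i phi psi :
    ~ occurs (acst i) phi -> ~ occurs (acst i) psi ->
    proof G1 (Ex v phi) ->
    proof G2 psi -> discharge (subst v (a_ i) phi) G2 H2 ->
    (forall o, List.In o H2 -> o.1 <> subst v (a_ i) phi) ->
    fresh_in i H2 ->
    proof (G1 ++ H2) psi.

Definition derives (Gamma : sent -> Prop) phi : Prop :=
  exists G (_ : proof G phi), forall o, List.In o G -> Gamma o.1.

Lemma tfree_tsubst v s t x :
  tfree x t -> x <> v -> tfree x (tsubst v s t).
Proof.
elim: t => //= [y <- /eqP/negbTE -> //|f ts IH [i xi] xv].
by exists i; apply: IH.
Qed.

Lemma free_subst v s phi x :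
  free x phi -> x <> v -> free x (subst v s phi).
Proof.
elim: phi => //= [r ts [i xi] xv|p IHp q IHq|p IHp q IHq|p IHp q IHq|y p IH|y p IH].
- by exists i; apply: tfree_tsubst.
- by case=> [/IHp|/IHq] H /H; [left|right].
- by case=> [/IHp|/IHq] H /H; [left|right].
- by case=> [/IHp|/IHq] H /H; [left|right].
- by case=> xy fx xv; split=> //; case: eqP => // _; apply: IH.
- by case=> xy fx xv; split=> //; case: eqP => // _; apply: IH.
Qed.

Lemma tfree_tsubst_inv v s t x :
  closed s -> tfree x (tsubst v s t) -> tfree x t /\ x <> v.
Proof.
move=> cs; elim: t => //= [y|f ts IH [i /IH [xi xv]]]; last by split=> //; exists i.
by case: eqP => [_ /cs //|yv /= ->].
Qed.

Lemma free_subst_inv v s phi x :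
  closed s -> free x (subst v s phi) -> free x phi /\ x <> v.
Proof.
move=> cs.
elim: phi => //= [r ts [i /(tfree_tsubst_inv cs) [xi xv]]|p IHp q IHq|p IHp q IHq|p IHp q IHq|y p IH|y p IH].
- by split=> //; exists i.
- by case=> [/IHp|/IHq] [? ?]; split=> //; [left|right].
- by case=> [/IHp|/IHq] [? ?]; split=> //; [left|right].
- by case=> [/IHp|/IHq] [? ?]; split=> //; [left|right].
- by case: (y =P v) => [-> [xv fx]|_ [xy /IH [fx xv]]].
- by case: (y =P v) => [-> [xv fx]|_ [xy /IH [fx xv]]].
Qed.

(* Every node of a proof is the root of a subproof, so this says that only
   sentences occur in proofs. *)
Lemma proof_sentence G phi : proof G phi -> sentence phi.
Proof.
elim=> {G phi} //.
- by move=> x [].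
- by move=> ? ? ? ? _ Hp _ Hq x /= [/Hp|/Hq].
- by move=> ? ? ? _ H x Hx; apply: (H x); left.
- by move=> ? ? ? _ H x Hx; apply: (H x); right.
- by move=> ? ? ? Hp _ Hq x /= [/Hq|/Hp].
- by move=> ? ? ? Hp _ Hq x /= [/Hp|/Hq].
- by move=> ? ? ? ? Hp _ Hq _ x /= [/Hp|/Hq].
- by move=> ? ? ? ? _ _ _ H x Hx; apply: (H x); right.
- by move=> ? ? ? ? ? _ H _ H' x /= [Hx|Hx]; [apply: (H x); left|apply: (H' x); right].
- by move=> ? ? ? ? ? _ H _ H' x /= [Hx|[Hx|Hx]];
    [apply: (H x); left|apply: (H x); right|apply: (H' x); right].
- by move=> ? ? ? ? ? _ H _ H' x /= [[Hx|Hx]|Hx];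
    [apply: (H x); left|apply: (H' x); left|apply: (H x); right].
- by move=> ? v p q Hp _ H x /= [/Hp //|[xv Hx]]; apply: (H x); split=> //; right.
- by move=> ? v p q Hp _ H x /= [[xv Hx]|/Hp //]; apply: (H x); split=> //; left.
- by move=> ? v i p _ _ _ H x /= [xv Hx]; apply: (H x); apply: free_subst.
- by move=> ? v t p ct _ H x /(free_subst_inv ct) [fx xv]; apply: (H x).
- by move=> ? v p q Hp _ H x /= [/Hp //|[xv Hx]]; apply: (H x); split=> //; right.
- by move=> ? v t p ct _ H x /= [xv Hx]; apply: (H x); apply: free_subst.
Qed.

End Deduction.

(* Main.v *)
(* Let Gamma not derive phi.

   Call a derivation safe if it has no ->-Elim; every leaf is then safe, and safe
   derivability obeys the usual natural deduction rules. Modus ponens at the root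
   is recovered by the safe inference from p -> q and p to T -> q: "s, p safely
   give (T ->)^n q for some n" is a preorder on sentences that is contained in
   full derivability from s, contains modus ponens, and still has /\, \/ and the
   quantifiers as (distributive) lattice operations.

   For finite Gamma = s only countably many symbols matter. CD makes the
   quantifiers distributive infima and suprema over the closed terms of the
   fragment, so a Rasiowa-Sikorski argument separates p from q by a prime,
   saturated theory whenever p is not below q. Used with the preorder above it
   yields the reflexive root; used with "p -> q is in u" it yields the worlds
   accessible from u needed for the truth lemma.

   Arbitrary Gamma and uncountable languages follow by compactness, through an
   ultraproduct of the Kripke models obtained for the finite subsets of Gamma. *)
From mathcomp Require Import all_boot boolp classical_sets cardinality filter.
From Stdlib Require List.
Require Import Defs.

Set Implicit Arguments.
Unset Strict Implicit.
Unset Printing Implicit Defensive.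

Local Open Scope classical_set_scope.

(** * Substitution and fresh constants *)

Section Substitution.
Variable K : language.
Implicit Types (phi : form K) (t s : term K).

Lemma tsubst_id v s t : ~ tfree v t -> tsubst v s t = t.
Proof.
elim: t => //= [y|f ts IH] H; first by case: eqP => // e; case: H.
by congr App; apply: funext => i; apply: IH => Hi; apply: H; exists i.
Qed.

Lemma subst_id v s phi : ~ free v phi -> subst v s phi = phi.
Proof.
elim: phi => //= [r ts|p IHp q IHq|p IHp q IHq|p IHp q IHq|y p IH|y p IH] H.
- by congr Atom; apply: funext => i; apply: tsubst_id => Hi; apply: H; exists i.
- by rewrite IHp ?IHq // => Hf; apply: H; [right|left].
- by rewrite IHp ?IHq // => Hf; apply: H; [right|left].
- by rewrite IHp ?IHq // => Hf; apply: H; [right|left].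
- by case: eqP => // yv; rewrite IH // => Hf; apply: H; split=> // /esym.
- by case: eqP => // yv; rewrite IH // => Hf; apply: H; split=> // /esym.
Qed.

Lemma eval_closed (M : model K) (e e' : nat -> dom M) t :
  closed t -> eval e t = eval e' t.
Proof.
elim: t => //= [y H|f ts IH H]; first by case: (H y).
by congr ifun; apply: funext => i; apply: IH => x Hx; apply: (H x); exists i.
Qed.

Lemma eval_tsubst (M : model K) (e : nat -> dom M) v s t :
  eval e (tsubst v s t) = eval (upd e v (eval e s)) t.
Proof.
elim: t => //= [y|f ts IH]; first by rewrite /upd; case: eqP.
by congr ifun; apply: funext => i; apply: IH.
Qed.

Lemma upd_same (M : model K) (e : nat -> dom M) v a b :
  upd (upd e v a) v b = upd e v b.
Proof. by apply: funext => x; rewrite /upd; case: eqP. Qed.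

Lemma upd_swap (M : model K) (e : nat -> dom M) v x a b : x <> v ->
  upd (upd e v a) x b = upd (upd e x b) v a.
Proof.
move=> xv; apply: funext => y; rewrite /upd; case: eqP => // ->.
by case: eqP.
Qed.

Lemma sat_subst (M : model K) (w : world M) (e : nat -> dom M) v s phi :
  closed s -> sat w e (subst v s phi) <-> sat w (upd e v (eval e s)) phi.
Proof.
move=> cs; elim: phi w e => //= [r ts|p IHp q IHq|p IHp q IHq|p IHp q IHq|y p IH|y p IH] w e.
- by under [X in irel w X]funext do rewrite eval_tsubst.
- by rewrite IHp IHq.
- by rewrite IHp IHq.
- by split=> H u wu; move: (H u wu); rewrite IHp IHq.
- case: eqP => [->|yv]; split=> H b; move: (H b); rewrite ?upd_same //.
  + by rewrite IH (@upd_swap _ e v y) // (eval_closed (upd e y b) e).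
  + by rewrite IH (@upd_swap _ e v y) // (eval_closed (upd e y b) e).
- case: eqP => [->|yv]; split=> -[b H]; exists b; move: H; rewrite ?upd_same //.
  + by rewrite IH (@upd_swap _ e v y) // (eval_closed (upd e y b) e).
  + by rewrite IH (@upd_swap _ e v y) // (eval_closed (upd e y b) e).
Qed.

(** An induction measure invariant under substitution: the instances of a quantified formula are not
    its subformulas. *)
Fixpoint fsize phi : nat :=
  match phi with
  | Atom _ _ | Top | Bot => 0
  | And p q | Or p q | Imp p q => (fsize p + fsize q).+1
  | All _ p | Ex _ p => (fsize p).+1
  end.

Lemma fsize_subst v s phi : fsize (subst v s phi) = fsize phi.
Proof.
elim: phi => //= [p -> q ->|p -> q ->|p -> q ->|y p IH|y p IH] //; by case: eqP; rewrite ?IH.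
Qed.

(** Arities are finite, so the bounds for the arguments have a maximum. Fresh constants come from
    this. *)
Lemma toccurs_bound (c : nat -> cst K) t :
  (forall i j, c i = c j -> i = j) ->
  exists N, forall i, toccurs (c i) t -> i < N.
Proof.
move=> inj; elim: t => [y|d|f ts IH] /=; first by exists 0.
- case: (pselect (exists i, c i = d)) => [[i <-]|H].
    by exists i.+1 => j /inj ->.
  by exists 0 => i /esym Hi; case: H; exists i; rewrite Hi.
- have [N HN] := choice IH; exists (\max_i N i) => i [k /HN Hk].
  exact: leq_trans Hk (leq_bigmax k).
Qed.

Lemma occurs_bound (c : nat -> cst K) phi :
  (forall i j, c i = c j -> i = j) ->
  exists N, forall i, occurs (c i) phi -> i < N.
Proof.
move=> inj; elim: phi => //= [r ts|||p [N HN] q [N' HN']|p [N HN] q [N' HN']|p [N HN] q [N' HN']].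
- have [N HN] := choice (fun k => toccurs_bound (ts k) inj).
  exists (\max_i N i) => i [k /HN Hk]; exact: leq_trans Hk (leq_bigmax k).
- by exists 0.
- by exists 0.
- by exists (maxn N N') => i; rewrite leq_max => -[/HN ->|/HN' ->]; rewrite ?orbT.
- by exists (maxn N N') => i; rewrite leq_max => -[/HN ->|/HN' ->]; rewrite ?orbT.
- by exists (maxn N N') => i; rewrite leq_max => -[/HN ->|/HN' ->]; rewrite ?orbT.
Qed.

End Substitution.

Lemma countable_setU (T : Type) (X Y : set T) :
  countable X -> countable Y -> countable (X `|` Y).
Proof.
move=> cX cY; suff -> : X `|` Y = \bigcup_(b in setT) (if b then X else Y).
  by apply: bigcup_countable => // -[].
by apply/seteqP; split=> x => [[Xx|Yx]|[[] _ ?]]; [exists true|exists false|left|right].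
Qed.

(** * Countable fragments *)

Section Symbols.
Variable K : language.
Implicit Types (t s : term K) (p q : form K).

Definition sym : Type := (cst K + fsym K + rsym K)%type.
Implicit Type X : set sym.

Fixpoint tover X t : Prop :=
  match t with
  | Var _ => True
  | Cst c => X (inl (inl c))
  | App f ts => X (inl (inr f)) /\ forall i, tover X (ts i)
  end.

Fixpoint over X p : Prop :=
  match p with
  | Atom r ts => X (inr r) /\ forall i, tover X (ts i)
  | Top | Bot => True
  | And p q | Or p q | Imp p q => over X p /\ over X q
  | All _ p | Ex _ p => over X p
  end.

Lemma tover_sub X Y t : X `<=` Y -> tover X t -> tover Y t.
Proof.
move=> XY; elim: t => //= [c|f ts IH]; first exact: XY.
by case=> /XY Yf H; split=> // i; apply: IH.
Qed.

Lemma over_sub X Y p : X `<=` Y -> over X p -> over Y p.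
Proof.
move=> XY; elim: p => //= [r ts|p IHp q IHq|p IHp q IHq|p IHp q IHq];
  try by case=> /IHp ? /IHq ?.
by case=> /XY ? H; split=> // i; apply: tover_sub XY _.
Qed.

Lemma tover_tsubst X v s t : tover X s -> tover X t -> tover X (tsubst v s t).
Proof.
move=> Xs; elim: t => //= [y|f ts IH]; first by case: eqP.
by case=> ? H; split=> // i; apply: IH.
Qed.

Lemma over_subst X v s p : tover X s -> over X p -> over X (subst v s p).
Proof.
move=> Xs; elim: p => //= [r ts|p IHp q IHq|p IHp q IHq|p IHp q IHq|y p IH|y p IH];
  try by case=> /IHp ? /IHq ?.
- by case=> ? H; split=> // i; apply: tover_tsubst.
- by case: eqP => // _; apply: IH.
- by case: eqP => // _; apply: IH.
Qed.

Lemma countable_args n (A : Type) (P : set sym -> A -> Prop) (ts : 'I_n -> A) :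
  (forall X Y a, X `<=` Y -> P X a -> P Y a) ->
  (forall i, exists2 X, countable X & P X (ts i)) ->
  exists2 X, countable X & forall i, P X (ts i).
Proof.
move=> mono H.
have /choice[Y HY] : forall i, exists X, countable X /\ P X (ts i).
  by move=> i; have [X cX PX] := H i; exists X.
exists (\bigcup_(i in setT) Y i); last first.
  by move=> i; apply: mono (HY i).2 => x Yx; exists i.
by apply: bigcup_countable => // i _; apply: (HY i).1.
Qed.

Lemma tover_countable t : exists2 X, countable X & tover X t.
Proof.
elim: t => [x|c|f ts IH] /=.
- by exists set0.
- by exists [set inl (inl c)].
- have [X cX HX] := countable_args tover_sub IH.
  exists ([set inl (inr f)] `|` X); first exact: countable_setU.
  by split; [left|move=> i; apply: tover_sub (HX i) => ? ?; right].
Qed.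

Lemma over_countable p : exists2 X, countable X & over X p.
Proof.
have two (Q R : form K) : (exists2 X, countable X & over X Q) ->
    (exists2 X, countable X & over X R) ->
    exists2 X, countable X & over X Q /\ over X R.
  move=> [X cX HX] [Y cY HY]; exists (X `|` Y); first exact: countable_setU.
  by split; [apply: over_sub HX|apply: over_sub HY] => x ?; [left|right].
elim: p => [r ts|||p IHp q IHq|p IHp q IHq|p IHp q IHq|//|//] /=;
  try exact: two; try by exists set0.
have [X cX HX] := countable_args tover_sub (fun i => tover_countable (ts i)).
exists ([set inr r] `|` X); first exact: countable_setU.
by split; [left|move=> i; apply: tover_sub (HX i) => ? ?; right].
Qed.

(** * Injective coding of a countable fragment *)

Section Code.
Variable idx : sym -> nat.
Import GenTree.

(** Arguments are functions, so they are listed along [enum] to obtain a finite tree, which can be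
    pickled into [nat]. *)
Fixpoint tcode t : tree nat :=
  match t with
  | Var x => Node 0 [:: Leaf x]
  | Cst c => Node 1 [:: Leaf (idx (inl (inl c)))]
  | App f ts =>
      Node 2 (Leaf (idx (inl (inr f))) :: [seq tcode (ts i) | i <- enum 'I_(far f)])
  end.

Fixpoint code p : tree nat :=
  match p with
  | Atom r ts =>
      Node 0 (Leaf (idx (inr r)) :: [seq tcode (ts i) | i <- enum 'I_(rar r)])
  | Top => Node 1 [::]
  | Bot => Node 2 [::]
  | And p q => Node 3 [:: code p; code q]
  | Or p q => Node 4 [:: code p; code q]
  | Imp p q => Node 5 [:: code p; code q]
  | All v p => Node 6 [:: Leaf v; code p]
  | Ex v p => Node 7 [:: Leaf v; code p]
  end.

Variable X : set sym.
Hypothesis idx_inj : forall x y, X x -> X y -> idx x = idx y -> x = y.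

Lemma tcode_inj t s : tover X t -> tover X s -> tcode t = tcode s -> t = s.
Proof.
elim: t s => [x|c|f ts IH] [y|d|g us] //=.
- by move=> _ _ [->].
- by move=> Xc Xd [/(idx_inj Xc Xd) [->]].
- case=> Xf Xts [Xg Xus] [/(idx_inj Xf Xg) [e]]; case: g / e us Xg Xus => us _ Xus.
  move=> /eq_in_map E; congr App; apply: funext => i.
  by apply: IH => //; apply: E; rewrite mem_enum.
Qed.

Lemma code_inj p q : over X p -> over X q -> code p = code q -> p = q.
Proof.
elim: p q => [r ts|||p IHp q IHq|p IHp q IHq|p IHp q IHq|v p IH|v p IH]
  [r' us|||p' q'|p' q'|p' q'|v' p'|v' p'] //=.
- case=> Xf Xts [Xg Xus] [/(idx_inj Xf Xg) [e]]; case: r' / e us Xg Xus => us _ Xus.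
  move=> /eq_in_map E; congr Atom; apply: funext => i.
  by apply: tcode_inj => //; apply: E; rewrite mem_enum.
- by case=> ? ? [? ?] [/IHp-> // /IHq->].
- by case=> ? ? [? ?] [/IHp-> // /IHq->].
- by case=> ? ? [? ?] [/IHp-> // /IHq->].
- by move=> ? ? [-> /IH->].
- by move=> ? ? [-> /IH->].
Qed.

End Code.

Lemma over_code X : countable X ->
  exists c : form K -> nat,
    forall p q, over X p -> over X q -> c p = c q -> p = q.
Proof.
case/countable_injP=> idx idx_inj; exists (pickle \o code idx) => p q Xp Xq.
move=> /(pcan_inj pickleK); apply: code_inj Xp Xq => x y Xx Xy.
by apply: idx_inj; rewrite inE.
Qed.

End Symbols.

(** * Safe derivations *)

Section Safe.
Variable L : language.
Notation sent := (form (plus L)).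
Implicit Types (p q r : sent) (D : set sent).

(** Only the open leaves have to be safe, so that all of them can still be discharged; a use of
    [ImpE] whose right premise has no open leaves is not excluded. *)
Definition sder D p : Prop :=
  exists G (_ : proof G p), forall o, List.In o G -> D o.1 /\ o.2 = false.

Lemma sder_sentence D p : sder D p -> sentence p.
Proof. by case=> G [pr _]; apply: proof_sentence pr. Qed.

Lemma sder_sub D E p : D `<=` E -> sder D p -> sder E p.
Proof. by move=> DE [G [pr H]]; exists G, pr => o /H[/DE]. Qed.

Lemma sder_ass D p : sentence p -> D p -> sder D p.
Proof. by move=> sp Dp; exists _, (Assume sp) => o /= [<-|[]]. Qed.

(** Being safe, all occurrences of [p] can be discharged at once; that none remains is what [ExE]
    demands. *)
Lemma discharge_safe D p (G : seq (leaf L)) :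
  (forall o, List.In o G -> (D `|` [set p]) o.1 /\ o.2 = false) ->
  exists H, discharge p G H /\
    forall o, List.In o H -> [/\ D o.1, o.1 <> p & o.2 = false].
Proof.
elim: G => [|[q b] G IH] HG; first by exists [::]; split=> //; constructor.
have [|H [dH HH]] := IH; first by move=> o ?; apply: HG; right.
have [/= Dq bf] := HG (q, b) (or_introl erefl).
case: (pselect (q = p)) => [->|qp].
  by exists H; split=> //; rewrite bf; constructor.
exists ((q, b) :: H); split; first by constructor.
by move=> o /= [<-|/HH //]; split=> //; case: Dq.
Qed.

Lemma in_cat D (G1 G2 : seq (leaf L)) :
  (forall o, List.In o G1 -> D o.1 /\ o.2 = false) ->
  (forall o, List.In o G2 -> D o.1 /\ o.2 = false) ->
  forall o, List.In o (G1 ++ G2) -> D o.1 /\ o.2 = false.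
Proof. by move=> H1 H2 o /List.in_app_iff[/H1|/H2]. Qed.

Lemma sder_top D : sder D Top.
Proof. by exists _, (TopI L). Qed.

Lemma sder_bot D p : sentence p -> sder D Bot -> sder D p.
Proof. by move=> sp [G [pr H]]; exists _, (BotE sp pr). Qed.

Lemma sder_and D p q : sder D p -> sder D q -> sder D (And p q).
Proof. by move=> [G [pr H]] [G' [pr' H']]; exists _, (AndI pr pr'); apply: in_cat. Qed.

Lemma sder_and1 D p q : sder D (And p q) -> sder D p.
Proof. by move=> [G [pr H]]; exists _, (AndE1 pr). Qed.

Lemma sder_and2 D p q : sder D (And p q) -> sder D q.
Proof. by move=> [G [pr H]]; exists _, (AndE2 pr). Qed.

Lemma sder_or1 D p q : sentence q -> sder D p -> sder D (Or p q).
Proof. by move=> sq [G [pr H]]; exists _, (OrI1 sq pr). Qed.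

Lemma sder_or2 D p q : sentence p -> sder D q -> sder D (Or p q).
Proof. by move=> sq [G [pr H]]; exists _, (OrI2 sq pr). Qed.

Lemma sder_orE D p q r :
  sder D (Or p q) -> sder (D `|` [set p]) r -> sder (D `|` [set q]) r -> sder D r.
Proof.
move=> [G [pr H]] [G1 [pr1 /discharge_safe[H1 [d1 HH1]]]].
move=> [G2 [pr2 /discharge_safe[H2 [d2 HH2]]]].
exists _, (OrE pr pr1 d1 pr2 d2); apply: in_cat => //.
by apply: in_cat => o; [move=> /HH1[]|move=> /HH2[]].
Qed.

Lemma sder_imp D p q : sentence p -> sder (D `|` [set p]) q -> sder D (Imp p q).
Proof.
move=> sp [G [pr /discharge_safe[H [d HH]]]].
by exists _, (ImpI sp pr d) => o /HH[].
Qed.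

Lemma sder_trans D p q r :
  sder D (Imp p q) -> sder D (Imp q r) -> sder D (Imp p r).
Proof.
by move=> [G [pr H]] [G' [pr' H']]; exists _, (IntTrans pr pr'); apply: in_cat.
Qed.

Lemma sder_impand D p q r :
  sder D (Imp p q) -> sder D (Imp p r) -> sder D (Imp p (And q r)).
Proof.
by move=> [G [pr H]] [G' [pr' H']]; exists _, (IntAndI pr pr'); apply: in_cat.
Qed.

Lemma sder_impor D p q r :
  sder D (Imp p r) -> sder D (Imp q r) -> sder D (Imp (Or p q) r).
Proof.
by move=> [G [pr H]] [G' [pr' H']]; exists _, (IntOrE pr pr'); apply: in_cat.
Qed.

Lemma sder_impall D v p q :
  sentence p -> sder D (All v (Imp p q)) -> sder D (Imp p (All v q)).
Proof. by move=> sp [G [pr H]]; exists _, (IntAllI sp pr). Qed.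

Lemma sder_impex D v p q :
  sentence q -> sder D (All v (Imp p q)) -> sder D (Imp (Ex v p) q).
Proof. by move=> sp [G [pr H]]; exists _, (IntExE sp pr). Qed.

Lemma sder_all D v i p :
  ~ occurs (acst L i) p -> (forall q, D q -> ~ occurs (acst L i) q) ->
  sder D (subst v (a_ L i) p) -> sder D (All v p).
Proof.
move=> np nD [G [pr H]].
by have nG : fresh_in i G; [move=> o /H[/nD]|exists _, (AllI np nG pr)].
Qed.

Lemma sder_allE D v t p : closed t -> sder D (All v p) -> sder D (subst v t p).
Proof. by move=> ct [G [pr H]]; exists _, (AllE ct pr). Qed.

Lemma sder_cd D v p q :
  sentence p -> sder D (All v (Or p q)) -> sder D (Or p (All v q)).
Proof. by move=> sp [G [pr H]]; exists _, (CD sp pr). Qed.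

Lemma sder_ex D v t p : closed t -> sder D (subst v t p) -> sder D (Ex v p).
Proof. by move=> ct [G [pr H]]; exists _, (ExI ct pr). Qed.

Lemma sder_exE D v i p q :
  ~ occurs (acst L i) p -> ~ occurs (acst L i) q ->
  (forall r, D r -> ~ occurs (acst L i) r) ->
  sder D (Ex v p) -> sder (D `|` [set subst v (a_ L i) p]) q -> sder D q.
Proof.
move=> np nq nD [G [pr H]] [G2 [pr2 /discharge_safe[H2 [d2 HH2]]]].
have ne o : List.In o H2 -> o.1 <> subst v (a_ L i) p by case/HH2.
have fr : fresh_in i H2 by move=> o /HH2[/nD].
by exists _, (ExE np nq pr pr2 d2 ne fr); apply: in_cat => // o /HH2[].
Qed.

(* There is no [ImpE] in safe derivations; [OrE] on [Or p p] performs the cut. *)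
Lemma sder_cut D p q : sder D p -> sder (D `|` [set p]) q -> sder D q.
Proof.
move=> dp dq; apply: (sder_orE (p := p) (q := p)) => //.
exact: sder_or1 (sder_sentence dp) dp.
Qed.

Lemma sder_ass1 D p : sentence p -> sder (D `|` [set p]) p.
Proof. by move=> sp; apply: sder_ass => //; right. Qed.

Lemma sder_weak D E p : sder D p -> sder (D `|` E) p.
Proof. by apply: sder_sub => ? ?; left. Qed.

Lemma fresh_const (s : seq sent) :
  exists i, forall p, List.In p s -> ~ occurs (acst L i) p.
Proof.
suff [N HN] : exists N, forall p i, List.In p s -> occurs (acst L i) p -> i < N.
  by exists N => p ps /(HN _ _ ps); rewrite ltnn.
elim: s => [|p s [N HN]]; first by exists 0.
have [M HM] : exists M, forall i, occurs (acst L i) p -> i < M.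
  by apply: occurs_bound => i j [].
exists (maxn N M) => q i [<- /HM|qs /(HN _ _ qs)]; rewrite leq_max => -> //.
by rewrite orbT.
Qed.

Lemma closed_a i : closed (a_ L i).
Proof. by move=> x []. Qed.

(** The distributive law for [Ex], by [ExE] with a fresh constant; its dual for [All] is the rule
    [CD]. *)
Lemma sder_and_ex v p q : sentence p -> sentence (Ex v q) ->
  sder [set And p (Ex v q)] (Ex v (And p q)).
Proof.
move=> sp sq; set R := And p (Ex v q).
have sR : sentence R by move=> x /= [/sp|/sq].
have dR : sder [set R] R by apply: sder_ass.
have [i Hi] := fresh_const [:: R; q; p].
have nq : ~ occurs (acst L i) q by apply: Hi; right; left.
have np : ~ occurs (acst L i) p by apply: Hi; right; right; left.
have sqi : sentence (subst v (a_ L i) q).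
  by move=> x /(free_subst_inv (@closed_a i))[fx xv]; apply: (sq x).
apply: (sder_exE (i := i) (v := v) (p := q)) => //.
- by move=> /= [].
- by move=> r ->; apply: Hi; left.
- exact: sder_and2 dR.
apply: (sder_ex (t := a_ L i)) => //=; first exact: closed_a.
rewrite (subst_id _ (sp v)).
apply: sder_and; last exact: sder_ass1.
by apply: sder_weak; apply: sder_and1 dR.
Qed.

End Safe.

(** * Separation by prime saturated theories *)

Section Fragment.
Variable L : language.
Notation sent := (form (plus L)).
Variable X : set (sym (plus L)).
Hypothesis X_a : forall i, X (inl (inl (acst L i))).
Implicit Types (p q r : sent) (D : set sent) (t : term (plus L)).

Definition fsent p : Prop := sentence p /\ over X p.
Definition fterm t : Prop := closed t /\ tover X t.

Lemma fterm_a i : fterm (a_ L i).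
Proof. by split; [apply: closed_a|apply: X_a]. Qed.

Lemma fsent_and p q : fsent (And p q) <-> fsent p /\ fsent q.
Proof.
split=> [[s [op oq]]|[[sp op] [sq oq]]]; last by split=> // x [/sp|/sq].
by split; split=> // x Hx; apply: (s x); [left|right].
Qed.

Lemma fsent_or p q : fsent (Or p q) <-> fsent p /\ fsent q.
Proof. exact: fsent_and. Qed.

Lemma fsent_imp p q : fsent (Imp p q) <-> fsent p /\ fsent q.
Proof. exact: fsent_and. Qed.

Lemma fsent_top : fsent Top.
Proof. by split=> // x []. Qed.

Lemma fsent_bot : fsent Bot.
Proof. by split=> // x []. Qed.

Lemma fsent_subst v t p : fterm t -> fsent (All v p) -> fsent (subst v t p).
Proof.
move=> [ct ot] [sp op]; split; last exact: over_subst.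
by move=> x /(free_subst_inv ct)[fx xv]; apply: (sp x).
Qed.

(** Common abstraction of the two preorders in which sentences get separated. It is a distributive
    lattice preorder, distributivity coming from [le_ent]; the last two clauses make quantified
    sentences the infima and suprema of their instances over the closed terms of the fragment. *)
Record ent_order (le : sent -> sent -> Prop) : Prop := {
  le_ent : forall p q, fsent p -> fsent q -> sder [set p] q -> le p q;
  le_trans : forall p q r, fsent p -> fsent q -> fsent r ->
    le p q -> le q r -> le p r;
  le_and : forall p q r, fsent p -> fsent q -> fsent r ->
    le p q -> le p r -> le p (And q r);
  le_or : forall p q r, fsent p -> fsent q -> fsent r ->
    le p r -> le q r -> le (Or p q) r;
  le_all : forall p v q, fsent p -> fsent (All v q) ->
    (forall t, fterm t -> le p (subst v t q)) -> le p (All v q);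
  le_ex : forall p v q, fsent q -> fsent (Ex v p) ->
    (forall t, fterm t -> le (subst v t p) q) -> le (Ex v p) q }.

(** Proper prime filters for safe entailment, with witnesses for [Ex] and the omega-rule for [All].
    Closure under modus ponens is not demanded: it amounts to reflexivity of the world. *)
Record prime_theory (u : set sent) : Prop := {
  pt_fsent : forall p, u p -> fsent p;
  pt_ent : forall p q, u p -> fsent q -> sder [set p] q -> u q;
  pt_and : forall p q, u p -> u q -> u (And p q);
  pt_top : u Top;
  pt_bot : ~ u Bot;
  pt_or : forall p q, u (Or p q) -> u p \/ u q;
  pt_ex : forall v p, u (Ex v p) -> exists2 t, fterm t & u (subst v t p);
  pt_all : forall v p, fsent (All v p) ->
    (forall t, fterm t -> u (subst v t p)) -> u (All v p) }.

(** * Rasiowa-Sikorski construction of a prime theory *)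

Section Separation.
Variables (le : sent -> sent -> Prop) (c : sent -> nat).
Hypothesis leP : ent_order le.
Hypothesis c_inj : forall p q, over X p -> over X q -> c p = c q -> p = q.

Let sub p q fp fq := @le_ent le leP p q fp fq.

Lemma le_refl p : fsent p -> le p p.
Proof. by move=> fp; apply: sub => //; apply: sder_ass => //; apply: fp.1. Qed.

Lemma le_andl p q : fsent p -> fsent q -> le (And p q) p.
Proof.
move=> fp fq; have fa : fsent (And p q) by apply/fsent_and.
by apply: sub => //; apply: (sder_and1 (q := q)); apply: sder_ass => //; apply: fa.1.
Qed.

Lemma le_andr p q : fsent p -> fsent q -> le (And p q) q.
Proof.
move=> fp fq; have fa : fsent (And p q) by apply/fsent_and.
by apply: sub => //; apply: (sder_and2 (p := p)); apply: sder_ass => //; apply: fa.1.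
Qed.

Lemma le_orl p q : fsent p -> fsent q -> le p (Or p q).
Proof.
move=> fp fq; have fa : fsent (Or p q) by apply/fsent_or.
by apply: sub => //; apply: sder_or1 fq.1 _; apply: sder_ass => //; apply: fp.1.
Qed.

Lemma le_orr p q : fsent p -> fsent q -> le q (Or p q).
Proof.
move=> fp fq; have fa : fsent (Or p q) by apply/fsent_or.
by apply: sub => //; apply: sder_or2 fp.1 _; apply: sder_ass => //; apply: fq.1.
Qed.

Lemma le_inst v t p : fterm t -> fsent (All v p) -> le (All v p) (subst v t p).
Proof.
move=> ft fp; apply: sub => //; first exact: fsent_subst.
by apply: sder_allE ft.1 _; apply: sder_ass => //; apply: fp.1.
Qed.

Lemma le_wit v t p : fterm t -> fsent (Ex v p) -> le (subst v t p) (Ex v p).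
Proof.
move=> ft fp; have fs : fsent (subst v t p) by apply: fsent_subst.
by apply: sub => //; apply: sder_ex ft.1 _; apply: sder_ass => //; apply: fs.1.
Qed.

(** By distributivity, [p] is below [And p (Or q r)], hence below [Or q (And p r)], hence below
    [q]. *)
Lemma le_cut p q r : fsent p -> fsent q -> fsent r ->
  le (And p r) q -> le p (Or q r) -> le p q.
Proof.
move=> fp fq fr H1 H2.
have fqr : fsent (Or q r) by apply/fsent_or.
have fpr : fsent (And p r) by apply/fsent_and.
have fa : fsent (And p (Or q r)) by apply/fsent_and.
have fo : fsent (Or q (And p r)) by apply/fsent_or.
apply: (le_trans leP (q := And p (Or q r))) => //.
  by apply: le_and => //; apply: le_refl.
apply: (le_trans leP (q := Or q (And p r))) => //.
  apply: sub => //.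
  have d : sder [set And p (Or q r)] (And p (Or q r)) by apply: sder_ass fa.1 _.
  apply: (sder_orE (sder_and2 d)).
    by apply: sder_or1 fpr.1 _; apply: sder_ass1 fq.1.
  apply: sder_or2 fq.1 _; apply: sder_and; last exact: sder_ass1 fr.1.
  by apply: sder_weak; apply: sder_and1 d.
by apply: le_or => //; apply: le_refl.
Qed.

(** [And p (Ex v r)] lies below [Ex v (And p r)], the supremum of its instances, so these cannot all
    be below [q]. *)
Lemma le_ex_wit p q v r : fsent p -> fsent q -> fsent (Ex v r) ->
  ~ le (And p (Ex v r)) q -> exists2 t, fterm t & ~ le (And p (subst v t r)) q.
Proof.
move=> fp fq fr nle; apply: contrapT => H; apply: nle.
have fe : fsent (Ex v (And p r)).
  split; last by split; [exact: fp.2|exact: fr.2].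
  by move=> x /= [xv [/fp.1 //|fx]]; apply: (fr.1 x).
have fl : fsent (And p (Ex v r)) by apply/fsent_and.
apply: (le_trans leP (q := Ex v (And p r))) => //.
  by apply: sub => //; apply: sder_and_ex; [exact: fp.1|exact: fr.1].
apply: le_ex => // t ft /=; rewrite (subst_id _ (fp.1 v)).
by apply: contrapT => nle; apply: H; exists t.
Qed.

(** The rule [CD] enters here: it puts [All v (Or q r)], the infimum of its instances, below
    [Or q (All v r)]. *)
Lemma le_all_wit p q v r : fsent p -> fsent q -> fsent (All v r) ->
  ~ le p (Or q (All v r)) -> exists2 t, fterm t & ~ le p (Or q (subst v t r)).
Proof.
move=> fp fq fr nle; apply: contrapT => H; apply: nle.
have fe : fsent (All v (Or q r)).
  split; last by split; [exact: fq.2|exact: fr.2].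
  by move=> x /= [xv [/fq.1 //|fx]]; apply: (fr.1 x).
have fl : fsent (Or q (All v r)) by apply/fsent_or.
apply: (le_trans leP (q := All v (Or q r))) => //; last first.
  by apply: sub => //; apply: sder_cd fq.1 _; apply: sder_ass fe.1 _.
apply: le_all => // t ft /=; rewrite (subst_id _ (fq.1 v)).
by apply: contrapT => nle; apply: H; exists t.
Qed.

Definition inside p r : Prop :=
  le p r /\ forall v s, r = Ex v s -> exists2 t, fterm t & le p (subst v t s).

Definition outside q r : Prop :=
  le r q /\ forall v s, r = All v s -> exists2 t, fterm t & le (subst v t s) q.

(** A stage of the construction: the final theory contains what is above [lo] and nothing below
    [hi]. *)
Record apart := Apart {
  lo : sent; hi : sent;
  lo_f : fsent lo; hi_f : fsent hi; lo_hi : ~ le lo hi }.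

(** By [le_cut], [r] can be joined to [lo] or to [hi] while these stay apart. When a witness is
    required, the instance takes the place of [r], since it lies below an existential and above a
    universal [r]. *)
Lemma decide (a : apart) r : fsent r ->
  exists b : apart, [/\ le (lo b) (lo a), le (hi a) (hi b) &
    inside (lo b) r \/ outside (hi b) r].
Proof.
move: a => [p q fp fq npq] fr /=.
case: (pselect (le (And p r) q)) => [H|H].
- have nle : ~ le p (Or q r) by move=> H'; apply: npq; apply: le_cut H H'.
  case: (pselect (exists v s, r = All v s)) => [[v [s e]]|nall].
    subst r; have [t ft nt] := le_all_wit fp fq fr nle.
    have fs := fsent_subst ft fr.
    have fo : fsent (Or q (subst v t s)) by apply/fsent_or.
    exists (Apart fp fo nt); split=> /=; [exact: le_refl|exact: le_orl|right].
    have le1 : le (subst v t s) (Or q (subst v t s)) by apply: le_orr.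
    split=> [|v' s' [<- <-]]; last by exists t.
    by apply: (le_trans leP (q := subst v t s)) => //; apply: le_inst.
  have fo : fsent (Or q r) by apply/fsent_or.
  exists (Apart fp fo nle); split=> /=; [exact: le_refl|exact: le_orl|right].
  by split=> [|v s e]; [exact: le_orr|case: nall; exists v, s].
- case: (pselect (exists v s, r = Ex v s)) => [[v [s e]]|nex].
    subst r; have [t ft nt] := le_ex_wit fp fq fr H.
    have fs := fsent_subst ft fr.
    have fo : fsent (And p (subst v t s)) by apply/fsent_and.
    exists (Apart fo fq nt); split=> /=; [exact: le_andl|exact: le_refl|left].
    have le1 : le (And p (subst v t s)) (subst v t s) by apply: le_andr.
    split=> [|v' s' [<- <-]]; last by exists t.
    by apply: (le_trans leP (q := subst v t s)) => //; apply: le_wit.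
  have fo : fsent (And p r) by apply/fsent_and.
  exists (Apart fo fq H); split=> /=; [exact: le_andl|exact: le_refl|left].
  by split=> [|v s e]; [exact: le_andr|case: nex; exists v, s].
Qed.

Lemma decide_code (a : apart) n :
  exists b : apart, [/\ le (lo b) (lo a), le (hi a) (hi b) &
    forall r, fsent r -> c r = n -> inside (lo b) r \/ outside (hi b) r].
Proof.
case: (pselect (exists2 r, fsent r & c r = n)) => [[r fr <-]|H].
  have [b [H1 H2 H3]] := decide a fr; exists b; split=> // s fs e.
  by rewrite (c_inj fs.2 fr.2 e).
exists a; split=> [||r fr e]; last by case: H; exists r.
- exact: le_refl (lo_f a).
- exact: le_refl (hi_f a).
Qed.

(** Each sentence of the fragment is decided at the stage given by its code, so the upward closure
    of the lower bounds is prime and saturated. Its closure under [le] is recorded because it later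
    becomes accessibility. *)
Lemma separation p q : fsent p -> fsent q -> ~ le p q ->
  exists u, [/\ prime_theory u, u p, ~ u q &
    forall r s, u r -> fsent s -> le r s -> u s].
Proof.
move=> fp fq npq.
have /choice[next nextP] (an : apart * nat) := decide_code an.1 an.2.
pose a := fix a n := if n is m.+1 then next (a m, m) else Apart fp fq npq.
have lo_mono n m : n <= m -> le (lo (a m)) (lo (a n)).
  move=> /subnK <-; elim: (m - n) => [|k IH] /=; first exact: le_refl (lo_f _).
  apply: (le_trans leP _ _ _ _ IH); try exact: lo_f.
  by have [] := nextP (a (k + n), k + n).
have hi_mono n m : n <= m -> le (hi (a n)) (hi (a m)).
  move=> /subnK <-; elim: (m - n) => [|k IH] /=; first exact: le_refl (hi_f _).
  apply: (le_trans leP _ _ _ IH); try exact: hi_f.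
  by have [] := nextP (a (k + n), k + n).
(* Both bounds are compared at the common later stage [n + m]. *)
have disj n m : ~ le (lo (a n)) (hi (a m)).
  move=> H; apply: (@lo_hi (a (n + m))).
  apply: (le_trans leP (q := lo (a n))); try exact: lo_f; first exact: hi_f.
    exact: lo_mono (leq_addr _ _).
  apply: (le_trans leP (q := hi (a m))); try exact: hi_f; first exact: lo_f.
    exact: H.
  exact: hi_mono (leq_addl _ _).
have decided r : fsent r -> exists n, inside (lo (a n)) r \/ outside (hi (a n)) r.
  by move=> fr; exists (c r).+1; have [_ _] := nextP (a (c r), c r); apply.
pose u r := fsent r /\ exists n, le (lo (a n)) r.
have u_out r n : u r -> ~ le r (hi (a n)).
  move=> [fr [m Hm]] H; apply: (@disj m n).
  by apply: (le_trans leP _ fr _ Hm H); [exact: lo_f|exact: hi_f].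
have u_up r s : u r -> fsent s -> le r s -> u s.
  move=> [fr [n Hn]] fs rs; split=> //; exists n.
  by apply: (le_trans leP (lo_f _) fr).
exists u; split=> //; first last.
- by move=> uq; apply: (@u_out q 0 uq); apply: le_refl.
- by split=> //; exists 0; apply: le_refl.
have u_dec r n : u r -> ~ outside (hi (a n)) r by move=> Hr [H _]; apply: (@u_out r n).
split.
- by move=> r [].
- by move=> r s [fr Hr] fs d; apply: (u_up r) => //; apply: sub.
- move=> r s [fr [n Hn]] [fs [m Hm]]; split; first by apply/fsent_and.
  exists (n + m); apply: le_and => //; try exact: lo_f.
    by apply: (le_trans leP _ _ _ (lo_mono _ _ (leq_addr _ _)) Hn); try exact: lo_f.
  by apply: (le_trans leP _ _ _ (lo_mono _ _ (leq_addl _ _)) Hm); try exact: lo_f.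
- split; first exact: fsent_top.
  by exists 0; apply: sub; [exact: lo_f|exact: fsent_top|exact: sder_top].
- move=> ub; apply: (@u_out Bot 0 ub); apply: sub; [exact: fsent_bot|exact: hi_f|].
  by apply: sder_bot; [exact: (hi_f (a 0)).1|apply: sder_ass fsent_bot.1 _].
- move=> r s urs; have [frs _] := urs; have [fr fs] := (fsent_or r s).1 frs.
  have [n [[Hn _]|[Hn _]]] := decided r fr; first by left; split=> //; exists n.
  have [m [[Hm _]|[Hm _]]] := decided s fs; first by right; split=> //; exists m.
  (* With both disjuncts outside, the disjunction would be below [hi] at a common stage. *)
  case: (@u_out (Or r s) (n + m) urs); apply: le_or => //; try exact: hi_f.
    by apply: (le_trans leP _ _ _ Hn (hi_mono _ _ (leq_addr _ _))); try exact: hi_f.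
  by apply: (le_trans leP _ _ _ Hm (hi_mono _ _ (leq_addl _ _))); try exact: hi_f.
- move=> v r ur; have [fr _] := ur.
  have [n [[_ Hn]|/(u_dec _ _ ur) //]] := decided _ fr.
  have [t ft Ht] := Hn v r erefl; exists t => //.
  by split; [apply: fsent_subst|exists n].
- move=> v r fr H.
  (* Were the universal sentence outside, one of its instances would be below some [hi], although
     all of them are in [u]. *)
  have [n [[Hn _]|[_ Hn]]] := decided _ fr; first by split=> //; exists n.
  have [t ft Ht] := Hn v r erefl.
  by case: (@u_out (subst v t r) n (H t ft)).
Qed.

End Separation.

End Fragment.

(** * The root preorder and the preorder of a world *)

Section Box.
Variable L : language.
Notation sent := (form (plus L)).
Implicit Types (p q r : sent) (D : set sent).

(* At a reflexive world [box n p] holds iff [p] does; [box 1] turns modus ponens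
   into a safe inference: [Imp p q] and [p] safely give [box 1 q]. *)
Definition box n p : sent := iter n (Imp Top) p.

Lemma box_subst n v t p : subst v t (box n p) = box n (subst v t p).
Proof. by elim: n => //= n ->. Qed.

Lemma box_occurs n c p : occurs c (box n p) -> occurs c p.
Proof. by elim: n => //= n IH [//|/IH]. Qed.

Lemma sder_boxI D n p : sder D p -> sder D (box n p).
Proof.
elim: n => //= n IH /IH H.
by apply: sder_imp; [move=> x []|apply: sder_weak].
Qed.

(** The passage from [box n p] to [box n q] is internalised by [ImpI] and composed with the premise
    by [IntTrans], so no leaf becomes unsafe. *)
Lemma sder_box_bind D n p q :
  sder D (box n p) -> sder (D `|` [set p]) q -> sder D (box n q).
Proof.
elim: n D => [|n IH] D /=; first exact: sder_cut.
move=> dp dq; apply: (sder_trans dp).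
have sb : sentence (box n p) by move=> x Hx; apply: (sder_sentence dp (x := x)); right.
apply: sder_imp => //; apply: IH; first exact: sder_ass1.
by apply: sder_sub dq => x [?|?]; [left; left|right].
Qed.

(** [IntAllI] with antecedent [Top] moves one box past the quantifier at a time. *)
Lemma sder_box_all D n v p : sder D (All v (box n p)) -> sder D (box n (All v p)).
Proof.
elim: n D => //= n IH D d.
have d' : sder D (Imp Top (All v (box n p))) by apply: sder_impall => // x [].
apply: (sder_trans d').
have sb : sentence (All v (box n p)).
  by move=> x Hx; apply: (sder_sentence d' (x := x)); right.
by apply: sder_imp => //; apply: IH; apply: sder_ass1.
Qed.

End Box.

Section Orders.
Variable L : language.
Notation sent := (form (plus L)).
Variable X : set (sym (plus L)).
Hypothesis X_a : forall i, X (inl (inl (acst L i))).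
Implicit Types (p q r : sent) (D : set sent) (t : term (plus L)).

(* The Lindenbaum order at the root: consequence over [s] on reflexive worlds. *)
Definition root_le (s : seq sent) p q : Prop :=
  exists n, sder ([set r | List.In r s] `|` [set p]) (box n q).

(** Box depths add up under composition. In the quantifier clauses the depth may vary with the
    instance; the instance at a fresh constant supplies one depth that serves for the
    generalisation. *)
Lemma root_order (s : seq sent) : ent_order X (root_le s).
Proof.
split.
- by move=> p q fp fq d; exists 0; apply: sder_sub d => x ->; right.
- move=> p q r fp fq fr [n d] [m d']; exists (n + m).
  rewrite /box iterD; apply: sder_box_bind d _.
  by apply: sder_sub d' => x [?|?]; [left; left|right].
- move=> p q r fp fq fr [n d] [m d']; exists (n + m).
  rewrite /box iterD; apply: sder_box_bind d _.
  apply: sder_box_bind; first exact: sder_weak d'.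
  by apply: sder_and; [apply: sder_weak; apply: sder_ass1 fq.1|apply: sder_ass1 fr.1].
- move=> p q r fp fq fr [n d] [m d']; exists (n + m).
  have sor : sentence (Or p q) by move=> x [/fp.1|/fq.1].
  apply: (sder_orE (p := p) (q := q)); first exact: sder_ass1.
    rewrite addnC /box iterD; apply: sder_boxI.
    by apply: sder_sub d => x [?|?]; [left; left|right].
  rewrite /box iterD; apply: sder_boxI.
  by apply: sder_sub d' => x [?|?]; [left; left|right].
- move=> p v q fp fq H.
  have [i Hi] := fresh_const (q :: p :: s).
  have [n d] := H _ (fterm_a X_a i); exists n.
  apply: sder_box_all; apply: (sder_all (i := i)).
  + by move=> /box_occurs; apply: Hi; left.
  + by move=> r [rs|->]; apply: Hi; [right; right|right; left].
  + by rewrite box_subst.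
- move=> p v q fq fp H.
  have [i Hi] := fresh_const (q :: p :: s).
  have [n d] := H _ (fterm_a X_a i); exists n.
  apply: (sder_exE (i := i) (v := v) (p := p)).
  + by apply: Hi; right; left.
  + by move=> /box_occurs; apply: Hi; left.
  + by move=> r [rs|->]; [apply: Hi; right; right|apply: (Hi p); right; left].
  + exact: sder_ass1 fp.1.
  + by apply: sder_sub d => x [?|?]; [left; left|right].
Qed.

Lemma pt_ent2 (u : set sent) p q r : prime_theory X u -> u p -> u q -> fsent X r ->
  sder [set And p q] r -> u r.
Proof. by move=> up Hp Hq fr; apply: (pt_ent up) fr; apply: (pt_and up). Qed.

(** The clauses for composition and the connectives are internal rules applied inside [u]. For the
    quantifiers, [pt_all] first gathers the instances of the implication, to which [IntAllI] or
    [IntExE] applies. *)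
Lemma world_order (u : set sent) : prime_theory X u ->
  ent_order X (fun p q => u (Imp p q)).
Proof.
move=> up.
have two p q r : u p -> u q -> fsent X r ->
    (forall D, sder D p -> sder D q -> sder D r) -> u r.
  move=> Hp Hq fr d; apply: (pt_ent2 up Hp Hq fr).
  have [fp _] := pt_fsent up Hp; have [fq _] := pt_fsent up Hq.
  have da : sder [set And p q] (And p q) by apply: sder_ass => // x [/fp|/fq].
  by apply: d; [apply: sder_and1 da|apply: sder_and2 da].
split.
- move=> p q fp fq d; apply: (pt_ent up (pt_top up)); first exact/fsent_imp.
  by apply: sder_imp fp.1 _; apply: sder_sub d => x ->; right.
- move=> p q r fp fq fr Hpq Hqr; apply: (two _ _ _ Hpq Hqr); first exact/fsent_imp.
  by move=> D; apply: sder_trans.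
- move=> p q r fp fq fr Hpq Hpr; apply: (two _ _ _ Hpq Hpr).
    by apply/fsent_imp; split=> //; apply/fsent_and.
  by move=> D; apply: sder_impand.
- move=> p q r fp fq fr Hpr Hqr; apply: (two _ _ _ Hpr Hqr).
    by apply/fsent_imp; split=> //; apply/fsent_or.
  by move=> D; apply: sder_impor.
- move=> p v q fp fq H.
  have fa : fsent X (All v (Imp p q)).
    split; last by split; [exact: fp.2|exact: fq.2].
    by move=> x /= [xv [/fp.1 //|fx]]; apply: (fq.1 x).
  apply: (pt_ent up (p := All v (Imp p q))); last 2 first.
  + exact/fsent_imp.
  + by apply: sder_impall fp.1 _; apply: sder_ass fa.1 _.
  by apply: (pt_all up) => // t ft /=; rewrite (subst_id _ (fp.1 v)); apply: H.
- move=> p v q fq fp H.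
  have fa : fsent X (All v (Imp p q)).
    split; last by split; [exact: fp.2|exact: fq.2].
    by move=> x /= [xv [fx|/fq.1 //]]; apply: (fp.1 x).
  apply: (pt_ent up (p := All v (Imp p q))); last 2 first.
  + exact/fsent_imp.
  + by apply: sder_impex fq.1 _; apply: sder_ass fa.1 _.
  by apply: (pt_all up) => // t ft /=; rewrite (subst_id _ (fq.1 v)); apply: H.
Qed.

(** Chaining [Imp Top p] with [Imp p q] costs one box. This is the source of reflexivity at the
    root. *)
Lemma root_mp (s : seq sent) p q : fsent X p -> fsent X q ->
  root_le s (And p (Imp p q)) q.
Proof.
move=> fp fq; exists 1 => /=; set R := And p (Imp p q).
have sR : sentence R by move=> x [/fp.1|[/fp.1|/fq.1]].
have d : sder ([set r | List.In r s] `|` [set R]) R by apply: sder_ass1.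
apply: sder_trans (sder_and2 d).
by apply: sder_imp; [move=> x []|apply: sder_weak; apply: sder_and1 d].
Qed.

End Orders.

(** * The canonical model *)

Section Canonical.
Variable L : language.
Notation sent := (form (plus L)).
Variable X : set (sym (plus L)).
Hypothesis X_a : forall i, X (inl (inl (acst L i))).
Variable c : sent -> nat.
Hypothesis c_inj : forall p q, over X p -> over X q -> c p = c q -> p = q.
Implicit Types (p q r : sent) (t : term (plus L)).

Definition cworld : Type := {u : set sent | prime_theory X u}.
Definition cdom : Type := {t : term (plus L) | fterm X t}.

Definition cprec (u w : cworld) : Prop :=
  forall p q, sval u (Imp p q) -> sval w p -> sval w q.

(** A model interprets the symbols outside [X] too; the terms they form get the default value
    [a_ L 0]. *)
Definition to_cdom t : cdom :=
  match pselect (fterm X t) with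
  | left ft => exist _ t ft
  | right _ => exist _ (a_ L 0) (fterm_a X_a 0)
  end.

Lemma to_cdomK t : fterm X t -> sval (to_cdom t) = t.
Proof. by rewrite /to_cdom; case: pselect. Qed.

(** A vacuous [ImpI]. Implications thereby persist along [cprec], since every world contains
    [Top]. *)
Lemma pt_imp_mono (u : cworld) p q : sval u (Imp p q) -> sval u (Imp Top (Imp p q)).
Proof.
case: u => u up /= H; have [fs fo] := pt_fsent up H.
apply: (pt_ent up H); first by split=> // x /= [//|/fs].
by apply: sder_imp; [move=> x []|apply: sder_weak; apply: sder_ass].
Qed.

Lemma cprec_trans u w z : cprec u w -> cprec w z -> cprec u z.
Proof.
move=> uw wz p q /pt_imp_mono H; apply: wz; apply: uw H _.
exact: pt_top (svalP w).
Qed.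

Lemma cprec_sub u w p : cprec u w -> sval u p -> sval w p.
Proof.
move=> uw up; have [fs fo] := pt_fsent (svalP u) up.
apply: (uw Top); last exact: pt_top (svalP w).
apply: (pt_ent (svalP u) up); first by split=> // x /= [//|/fs].
by apply: sder_imp; [move=> x []|apply: sder_weak; apply: sder_ass].
Qed.

Definition cmodel (u0 : cworld) : model (plus L) :=
  @Model (plus L) cworld cprec cdom
    (fun d => to_cdom (Cst d))
    (fun f ts => to_cdom (App f (fun i => sval (ts i))))
    (fun R u ts => sval u (Atom R (fun i => sval (ts i))))
    (inhabits u0) (inhabits (to_cdom (a_ L 0)))
    cprec_trans (fun _ _ _ uw _ => cprec_sub uw).

Variable u0 : cworld.
Let M := cmodel u0.

Lemma eval_cmodel (e : nat -> dom M) t : fterm X t -> sval (eval e t) = t.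
Proof.
case; elim: t => [x H|d _ H|f ts IH ct [Hf H]]; first by case: (H x).
  by rewrite /= to_cdomK //; split=> // x [].
have E : (fun i => sval (eval e (ts i))) = ts.
  by apply: funext => i; apply: IH (H i) => x Hx; apply: (ct x); exists i.
by rewrite /= E to_cdomK //; split.
Qed.

Lemma fterm_eval (e : nat -> dom M) t (ft : fterm X t) :
  exist _ t ft = eval e t :> dom M.
Proof.
apply: eq_sig_hprop; first by move=> s; apply: Prop_irrelevance.
by rewrite eval_cmodel.
Qed.

(** Individuals are closed terms denoting themselves, so quantifiers range over exactly the
    instances governed by [pt_ex] and [pt_all]. *)
Lemma truth p (u : cworld) (e : nat -> dom M) : fsent X p ->
  @sat _ M u e p <-> sval u p.
Proof.
have [n] := ubnP (fsize p); elim: n p u e => // n IH p u e.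
have IH2 q r w : fsize q + fsize r < n -> fsent X q -> fsent X r ->
    (@sat _ M w e q <-> sval w q) /\ (@sat _ M w e r <-> sval w r).
  move=> szn fq fr; split; apply: IH => //; apply: leq_ltn_trans szn.
    exact: leq_addr.
  exact: leq_addl.
have up := svalP u.
case: p => [r ts|||p q|p q|p q|v p|v p]; rewrite ?ltnS /=.
- move=> _ [cl [_ H]]; suff -> : (fun i => sval (eval e (ts i))) = ts by [].
  apply: funext => i; apply: eval_cmodel; split; last exact: H.
  move=> x Hx.
  by apply: (cl x); exists i.
- by move=> _ _; split=> // _; apply: (pt_top up).
- by move=> _ _; split=> // /(pt_bot up).
- move=> szn fpq; have [fp fq] := (fsent_and _ _ _).1 fpq.
  have [IHp IHq] := IH2 p q u szn fp fq; rewrite IHp IHq.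
  split=> [[? ?]|H]; first exact: (pt_and up).
  have d : sder [set And p q] (And p q) by apply: sder_ass fpq.1 _.
  by split; [apply: (pt_ent up H fp (sder_and1 d))|apply: (pt_ent up H fq (sder_and2 d))].
- move=> szn fpq; have [fp fq] := (fsent_or _ _ _).1 fpq.
  have [IHp IHq] := IH2 p q u szn fp fq; rewrite IHp IHq.
  split=> [[H|H]|]; last exact: (pt_or up).
    by apply: (pt_ent up H fpq); apply: sder_or1 fq.1 _; apply: sder_ass fp.1 _.
  by apply: (pt_ent up H fpq); apply: sder_or2 fp.1 _; apply: sder_ass fq.1 _.
- move=> szn fpq; have [fp fq] := (fsent_imp _ _ _).1 fpq.
  have IHp w := (IH2 p q w szn fp fq).1; have IHq w := (IH2 p q w szn fp fq).2.
  split=> [H|H w uw /IHp Hp]; last by apply/IHq; apply: uw H Hp.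
  apply: contrapT => npq.
  (* Separation in the preorder of [u] yields a world with [p] and without [q]; its closure under
     that preorder is accessibility from [u]. *)
  have [z [zP zp zq zup]] := separation (world_order up) c_inj fp fq npq.
  apply: zq; apply/(IHq (exist _ z zP)); apply: H; last exact/IHp.
  move=> r s Hrs Hr /=; apply: (zup _ _ Hr _ Hrs).
  by have /fsent_imp[] := pt_fsent up Hrs.
- move=> szn fp.
  have IHp t : fterm X t -> @sat _ M u e (subst v t p) <-> sval u (subst v t p).
    by move=> ft; apply: IH; [rewrite fsize_subst|apply: fsent_subst].
  split=> [H|H b].
    apply: (pt_all up) => // t ft; apply/(IHp t ft).
    by apply/(sat_subst _ _ _ _ ft.1); apply: H.
  case: b => t ft; rewrite (fterm_eval e ft).
  apply/(sat_subst _ _ _ _ ft.1)/(IHp t ft).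
  apply: (pt_ent up H); first exact: fsent_subst.
  by apply: sder_allE ft.1 _; apply: sder_ass fp.1 _.
- move=> szn fp.
  have IHp t : fterm X t -> @sat _ M u e (subst v t p) <-> sval u (subst v t p).
    by move=> ft; apply: IH; [rewrite fsize_subst|apply: fsent_subst].
  split=> [[[t ft]]|/(pt_ex up)[t ft]].
    rewrite (fterm_eval e ft) => /(sat_subst _ _ _ _ ft.1)/(IHp t ft) Hu; apply: (pt_ent up Hu) => //.
    have fs : fsent X (subst v t p) by apply: fsent_subst.
    by apply: sder_ex ft.1 _; apply: sder_ass fs.1 _.
  by move=> /(IHp t ft)/(sat_subst _ _ _ _ ft.1) H; exists (eval e t).
Qed.

End Canonical.

(** * Completeness for finitely many premises *)

Lemma sder_box_derives (L : language) (D : form (plus L) -> Prop) n p :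
  sder D (box n p) -> derives D p.
Proof.
case=> G [pr HG]; suff [G' [pr' HG']] : exists G' (_ : proof G' p),
    forall o, List.In o G' -> D o.1 by exists G', pr'.
have {HG} : forall o, List.In o G -> D o.1 by move=> o /HG[].
elim: n G pr => [|n IH] G /= pr HG; first by exists G, pr.
(* Each [ImpE] against [Top] strips a box. It makes the open leaves unsafe, which is harmless as
   nothing is discharged afterwards. *)
apply: (IH _ (ImpE (TopI L) pr)) => o /List.in_map_iff[o' [<- /HG]]; exact.
Qed.

(** The failure of [p] is stated for all assignments, so that it applies to whichever one an
    ultraproduct induces on a factor. *)
Lemma finite_completeness (L : language) (s : seq (form (plus L))) p :
  (forall q, List.In q s -> sentence q) -> sentence p ->
  ~ derives (fun q => List.In q s) p ->
  exists (M : model (plus L)) (w : world M),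
    [/\ prec w w, forall q, List.In q s -> holds w q & forall e, ~ sat w e p].
Proof.
move=> ss sp nd.
have [Y cY HY] : exists2 Y, countable Y &
    forall q, List.In q (p :: s) -> over Y q.
  elim: (p :: s) => [|q l [Y cY HY]]; first by exists set0.
  have [Z cZ HZ] := over_countable q.
  exists (Z `|` Y); first exact: countable_setU.
  by move=> r [<-|/HY HYr]; [apply: over_sub HZ|apply: over_sub HYr] => x ?; [left|right].
(* Fresh constants must be terms of the fragment, so all [a_ L i] are added to it. *)
pose A : set (sym (plus L)) := range (fun i => inl (inl (acst L i))).
pose X := A `|` Y.
have X_a i : X (inl (inl (acst L i))) by left; exists i.
have cX : countable X.
  by apply: countable_setU => //; apply: card_le_trans (card_image_le _ _) _.
have [c c_inj] := over_code cX.
have fs q : List.In q (p :: s) -> sentence q -> fsent X q.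
  by move=> qs sq; split=> //; apply: over_sub (HY q qs) => x ?; right.
have fp : fsent X p by apply: fs => //; left.
have nle : ~ root_le s Top p.
  move=> [n d]; apply: nd; apply: (sder_box_derives (n := n)).
  exact: sder_cut (sder_top _) d.
have [u [uP _ up uup]] := separation (root_order X_a s) c_inj (fsent_top X) fp nle.
exists (cmodel X_a (exist _ u uP)), (exist _ u uP); split.
(* The root is reflexive because [u] is closed under [root_le], which contains modus ponens. *)
- move=> q r Hi Hq; have /fsent_imp[fq fr] := pt_fsent uP Hi.
  apply: (uup _ _ _ fr (root_mp s fq fr)); exact: (pt_and uP Hq Hi).
- move=> q qs e; have fq : fsent X q by apply: fs; [right|apply: ss].
  apply/(truth c_inj) => //=; apply: (uup Top q (pt_top uP)) => //.
  by exists 0; apply: sder_ass fq.1 _; left.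
- by move=> e /(truth c_inj _ _ fp).
Qed.

(** * Ultraproducts of models *)

Section Ultraproduct.
Variables (K : language) (I : Type) (F : set_system I).
Hypothesis F_ultra : UltraFilter F.
Variable N : I -> model K.

(* No quotient is needed: nothing in the semantics refers to equality of worlds
   or of individuals. *)
Let uworld := forall i, world (N i).
Let udom := forall i, dom (N i).

(** The family must be total, so an arbitrary element fills the indices without a witness. *)
Lemma uprod_choice (T : I -> Type) (P : forall i, T i -> Prop) :
  (forall i, inhabited (T i)) ->
  exists u : forall i, T i, forall i, (exists x, P i x) -> P i (u i).
Proof.
move=> H; suff h i : {x : T i | (exists x, P i x) -> P i x}.
  by exists (fun i => sval (h i)) => i; apply: (svalP (h i)).
apply: cid; case: (pselect (exists x, P i x)) => [[x Px]|nP]; first by exists x.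
by case: (H i) => x; exists x => /nP.
Qed.

Lemma uprod_inh (T : I -> Type) : (forall i, inhabited (T i)) -> inhabited (forall i, T i).
Proof.
by move=> /(uprod_choice (fun _ _ => True))[u _]; apply: inhabits.
Qed.

Lemma uprec_trans (w u z : uworld) :
  F [set i | prec (w i) (u i)] -> F [set i | prec (u i) (z i)] ->
  F [set i | prec (w i) (z i)].
Proof.
move=> H1 H2; apply: filterS (filterI H1 H2) => i [wu uz].
exact: prec_trans wu uz.
Qed.

Lemma urel_mono (r : rsym K) (w u : uworld) : F [set i | prec (w i) (u i)] ->
  forall d : 'I_(rar r) -> udom, F [set i | irel (w i) (fun k => d k i)] ->
  F [set i | irel (m := N i) (u i) (fun k => d k i)].
Proof.
move=> H1 d H2; apply: filterS (filterI H1 H2) => i [wu]; exact: irel_mono.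
Qed.

Definition uprod : model K :=
  @Model K uworld (fun w u => F [set i | prec (w i) (u i)]) udom
    (fun c i => icst (N i) c)
    (fun f d i => ifun (fun k => d k i))
    (fun r w d => F [set i | irel (w i) (fun k => d k i)])
    (uprod_inh (fun i => world_inh (N i))) (uprod_inh (fun i => dom_inh (N i)))
    uprec_trans urel_mono.

Lemma eval_uprod (e : nat -> dom uprod) t i : eval e t i = eval (fun x => e x i) t.
Proof.
by elim: t => //= f ts IH; congr ifun; apply: funext => k; apply: IH.
Qed.

Lemma upd_uprod (e : nat -> dom uprod) v b i :
  (fun x => upd e v b x i) = upd (fun x => e x i) v (b i).
Proof. by apply: funext => x; rewrite /upd; case: eqP. Qed.

Lemma ultraN (A : set I) : ~ F A <-> F (~` A).
Proof.
split=> [nA|nA FA]; first by have [] := in_ultra_setVsetC A F_ultra.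
apply: (@filter_not_empty _ F _).
by apply: filterS (filterI FA nA) => i [].
Qed.

(** Accessibility is itself defined through [F], so [Imp] is treated like a universal quantifier
    over worlds: counterexamples chosen at almost all indices form one in the product. *)
Lemma los p (w : world uprod) (e : nat -> dom uprod) :
  sat w e p <-> F [set i | sat (w i) (fun x => e x i) p].
Proof.
elim: p w e => [r ts|||p IHp q IHq|p IHp q IHq|p IHp q IHq|v p IH|v p IH] w e /=.
- suff -> : [set i | irel (w i) (fun k => eval e (ts k) i)] =
    [set i | irel (w i) (fun k => eval (fun x => e x i) (ts k))] by [].
  apply: funext => i; rewrite /mkset; congr irel; apply: funext => k.
  exact: eval_uprod.
- by split=> // _; apply: filterS filterT.
- by split=> // H; apply: (@filter_not_empty _ F _); apply: filterS H.
- rewrite IHp IHq; split=> [[H1 H2]|H]; first exact: filterS (filterI H1 H2).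
  by split; apply: filterS H => i [].
- rewrite IHp IHq; split=> [[H|H]|H].
    by apply: filterS H => i ?; left.
    by apply: filterS H => i ?; right.
  apply: contrapT => /not_orP[/ultraN H1 /ultraN H2].
  apply: (@filter_not_empty _ F _).
  by apply: filterS (filterI H (filterI H1 H2)) => i [[?|?] []].
- split=> [H|H u wu /IHp Hp]; last first.
    by apply/IHq; apply: filterS (filterI H (filterI wu Hp)) => i [Hi [/Hi]].
  apply: contrapT => /ultraN Hn.
  have [u Hu] := uprod_choice (fun i u => [/\ prec (w i) u,
    sat u (fun x => e x i) p & ~ sat u (fun x => e x i) q]) (fun i => world_inh (N i)).
  have {}Hn : F [set i | [/\ prec (w i) (u i),
      sat (u i) (fun x => e x i) p & ~ sat (u i) (fun x => e x i) q]].
    apply: filterS Hn => i Hi; apply: Hu; apply: contrapT => nex; apply: Hi => z wz zp.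
    by apply: contrapT => zq; apply: nex; exists z.
  have /IHq : @sat _ uprod u e q.
    apply: (H u); first by apply: filterS Hn => i [].
    by apply/IHp; apply: filterS Hn => i [].
  apply/ultraN; apply: filterS Hn => i [] //.
- split=> [H|H b]; last first.
    by apply/IH; apply: filterS H => i /= Hi; rewrite upd_uprod; apply: Hi.
  apply: contrapT => /ultraN Hn.
  have [b Hb] := uprod_choice (fun i b => ~ sat (w i) (upd (fun x => e x i) v b) p)
    (fun i => dom_inh (N i)).
  have /IH := H b; apply/ultraN; apply: filterS Hn => i Hi /=.
  by rewrite upd_uprod; apply: Hb; apply/existsNP.
- split=> [[b /IH H]|H].
    by apply: filterS H => i /=; rewrite upd_uprod; exists (b i).
  have [b Hb] := uprod_choice (fun i b => sat (w i) (upd (fun x => e x i) v b) p)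
    (fun i => dom_inh (N i)).
  by exists b; apply/IH; apply: filterS H => i /Hb /=; rewrite upd_uprod.
Qed.

End Ultraproduct.

(** * Compactness and arbitrary sets of premises *)

Theorem theorem7 (L : language) (Gamma : form (plus L) -> Prop)
    (phi : form (plus L))
    (Gamma_sent : forall psi, Gamma psi -> sentence psi)
    (phi_sent : sentence phi) :
  entails Gamma phi -> derives Gamma phi.
Proof.
move=> ent; apply: contrapT => nd.
pose I : Type := {s : seq (form (plus L)) | forall q, List.In q s -> Gamma q}.
have /choice[M MP] (s : I) : exists M : model (plus L), exists w : world M,
    [/\ prec w w, forall q, List.In q (sval s) -> holds w q & forall e, ~ sat w e phi].
  apply: finite_completeness => // [q /(svalP s)/Gamma_sent //|[G [pr HG]]].
  by apply: nd; exists G, pr => o /HG /(svalP s).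
have [w wP] : exists w : forall s : I, world (M s), forall s : I,
    [/\ prec (w s) (w s), forall q, List.In q (sval s) -> holds (w s) q &
      forall e, ~ sat (w s) e phi].
  by exists (fun s => sval (cid (MP s))) => s; apply: svalP (cid (MP s)).
(* Cones over finite parts of [Gamma]. Each contains its tip, and the cone over a concatenation lies
   in both cones, so they generate a proper filter. *)
pose above (s : I) : set I := [set s' : I | forall q, List.In q (sval s) -> List.In q (sval s')].
pose F0 : set_system I := [set A | exists s, above s `<=` A].
have F0_proper : ProperFilter F0.
  split=> [[s /(_ s)]|]; first by apply.
  split.
  - have h q : List.In q [::] -> Gamma q by [].
    by exists (exist _ _ h).
  - move=> A B [[s hs] HA] [[s' hs'] HB].
    have h q : List.In q (s ++ s') -> Gamma q by case/List.in_app_iff=> [/hs|/hs'].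
    exists (exist _ _ h) => z Hz.
    by split; [apply: HA|apply: HB] => q qs; apply: Hz; apply/List.in_app_iff; [left|right].
  - by move=> A B AB [s HA]; exists s; apply: subset_trans HA AB.
have [F [F_ultra F0F]] := ultraFilterLemma F0_proper.
have FT (A : set I) : (forall s, A s) -> F A by move=> H; apply: filterS filterT.
have := ent (uprod F_ultra M) w.
case: (dom_inh (uprod F_ultra M)) => d.
have rf : @prec _ (uprod F_ultra M) w w by apply: FT => s; have [] := wP s.
move=> /(_ rf) H; have /(_ (fun=> d))/los : holds (M := uprod F_ultra M) w phi.
  apply: H => q Gq e; apply/los; apply: F0F.
  (* On the cone over [[:: q]] every factor satisfies [q]. *)
  have h r : List.In r [:: q] -> Gamma r by case=> // <-.
  exists (exist _ _ h) => s /(_ q (or_introl erefl)) qs /=.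
  by have [_ /(_ _ qs) Hq _] := wP s; apply: Hq.
apply/ultraN => //; apply: FT => s; have [_ _] := wP s; exact.
Qed.
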